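(* Let $\mathsf{C}$ be a partializable Markov category. A morphism of $\mathsf{Partial}(\mathsf{C})$ represented by a span $X\xleftarrow{i}D\xrightarrow{f}Y$ is copyable in $\mathsf{Partial}(\mathsf{C})$ if and only if $f$ is deterministic in $\mathsf{C}$.
   Context: A CD category is a symmetric monoidal category $(\mathsf{C},\otimes,I)$ in which every object $X$ carries a commutative comonoid structure $\mathrm{copy}_X\colon X\to X\otimes X$, $\mathrm{del}_X\colon X\to I$, compatible with tensor products ($\mathrm{copy}_{X\otimes Y}$ is $\mathrm{copy}_X\otimes\mathrm{copy}_Y$ followed by swapping the two middle factors, and $\mathrm{del}_{X\otimes Y}=\mathrm{del}_X\otimes\mathrm{del}_Y$) and with $\mathrm{copy}_I=\mathrm{del}_I=\mathrm{id}_I$; coherence isomorphisms are suppressed. A morphism $f\colon X\to Y$ is total if $\mathrm{del}_Y\circ f=\mathrm{del}_X$, copyable if $\mathrm{copy}_Y\circ f=(f\otimes f)\circ\mathrm{copy}_X$, and deterministic if it is both. A Markov category is a CD category in which every morphism is total. A Markov category is positive if for all $u\colon X\to Y$, $v\colon Y\to Z$ with $v\circ u$ deterministic, $(u\otimes (v\circ u))\circ\mathrm{copy}_X=(\mathrm{id}_Y\otimes v)\circ\mathrm{copy}_Y\circ u$. A Markov category $\mathsf{C}$ is partializable if: (i) it is positive; (ii) pullbacks of deterministic monomorphisms along arbitrary morphisms exist and are themselves deterministic (monomorphisms); (iii) if $i\colon D\to X$ is a deterministic monomorphism then $i\otimes\mathrm{id}_A$ is a monomorphism for every object $A$. For $\mathsf{C}$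 partializable, the CD category $\mathsf{Partial}(\mathsf{C})$ has the objects of $\mathsf{C}$; its morphisms $X\to Y$ are equivalence classes of spans $X\xleftarrow{i}D\xrightarrow{f}Y$ (also written $(D,i,f)$) in $\mathsf{C}$ with $i$ a deterministic monomorphism, where $(D,i,f)\sim(D',i',f')$ iff there is an isomorphism $t\colon D\to D'$ with $i'\circ t=i$, $f'\circ t=f$. The composite of $(A,i,f)\colon X\to Y$ followed by $(B,j,g)\colon Y\to Z$ is $(C,i\circ u,g\circ v)$, where $A\xleftarrow{u}C\xrightarrow{v}B$ is the pullback of $f$ and $j$. The inclusion $\mathsf{C}\hookrightarrow\mathsf{Partial}(\mathsf{C})$ sends $f\colon X\to Y$ to $(X,\mathrm{id}_X,f)$. The tensor product is componentwise, $(A,i,f)\otimes(B,j,g)=(A\otimes B,i\otimes j,f\otimes g)$, and the copy and delete maps (and coherence isomorphisms) are the images of those of $\mathsf{C}$ under the inclusion. *)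

(* Defs.v *)
From Stdlib Require Import ssreflect ssrfun.
From Stdlib Require Import ProofIrrelevance PropExtensionality.
From Stdlib Require Import FunctionalExtensionality IndefiniteDescription.

Set Implicit Arguments.
Unset Strict Implicit.
Unset Printing Implicit Defensive.

Declare Scope cat_scope.
Local Open Scope cat_scope.

Reserved Notation "g ∘ f" (at level 40, left associativity).
Reserved Notation "X ⊗ Y" (at level 38, left associativity).
Reserved Notation "f ⊠ g" (at level 38, left associativity).

Record category := Category {
  obj :> Type;
  hom : obj -> obj -> Type;
  idm : forall X, hom X X;
  comp : forall X Y Z, hom Y Z -> hom X Y -> hom X Z;
  comp_idl : forall X Y (f : hom X Y), comp (idm Y) f = f;
  comp_idr : forall X Y (f : hom X Y), comp f (idm X) = f;
  comp_assoc : forall W X Y Z (h : hom Y Z) (g : hom X Y) (f : hom W X),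
    comp h (comp g f) = comp (comp h g) f
}.

Arguments hom {c} X Y.
Arguments idm {c} X.
Arguments comp {c X Y Z} g f : rename.
Notation "g ∘ f" := (comp g f) : cat_scope.

Definition is_iso (C : category) (X Y : C) (f : hom X Y) : Prop :=
  exists g : hom Y X, g ∘ f = idm X /\ f ∘ g = idm Y.

Definition monic (C : category) (X Y : C) (m : hom X Y) : Prop :=
  forall (T : C) (a b : hom T X), m ∘ a = m ∘ b -> a = b.

Definition is_pullback (C : category) (X Y Z P : C) (f : hom X Z) (g : hom Y Z)
    (u : hom P X) (v : hom P Y) : Prop :=
  f ∘ u = g ∘ v /\
  forall (T : C) (a : hom T X) (b : hom T Y), f ∘ a = g ∘ b ->
    exists! w : hom T P, u ∘ w = a /\ v ∘ w = b.

(* Not assumed strict: the coherence isomorphisms are explicit.  On objects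
   the tensor product is written X ⊗ Y, on morphisms f ⊠ g. *)
Record symmetric_monoidal := SymmetricMonoidal {
  sm_cat :> category;
  unit_ob : sm_cat;
  tensor : sm_cat -> sm_cat -> sm_cat;
  tensor_hom : forall X Y X' Y' : sm_cat,
    hom X Y -> hom X' Y' -> hom (tensor X X') (tensor Y Y');
  assoc : forall X Y Z : sm_cat,
    hom (tensor (tensor X Y) Z) (tensor X (tensor Y Z));
  assocV : forall X Y Z : sm_cat,
    hom (tensor X (tensor Y Z)) (tensor (tensor X Y) Z);
  lunit : forall X : sm_cat, hom (tensor unit_ob X) X;
  lunitV : forall X : sm_cat, hom X (tensor unit_ob X);
  runit : forall X : sm_cat, hom (tensor X unit_ob) X;
  runitV : forall X : sm_cat, hom X (tensor X unit_ob);
  braid : forall X Y : sm_cat, hom (tensor X Y) (tensor Y X);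
  tensor_id : forall X Y : sm_cat,
    tensor_hom (idm X) (idm Y) = idm (tensor X Y);
  tensor_comp : forall (X Y Z X' Y' Z' : sm_cat)
      (g : hom Y Z) (f : hom X Y) (g' : hom Y' Z') (f' : hom X' Y'),
    tensor_hom (g ∘ f) (g' ∘ f') = tensor_hom g g' ∘ tensor_hom f f';
  assocVK : forall X Y Z, assoc X Y Z ∘ assocV X Y Z = idm _;
  assocK : forall X Y Z, assocV X Y Z ∘ assoc X Y Z = idm _;
  lunitVK : forall X, lunit X ∘ lunitV X = idm _;
  lunitK : forall X, lunitV X ∘ lunit X = idm _;
  runitVK : forall X, runit X ∘ runitV X = idm _;
  runitK : forall X, runitV X ∘ runit X = idm _;
  braidK : forall X Y, braid Y X ∘ braid X Y = idm _;
  assoc_nat : forall (X Y Z X' Y' Z' : sm_cat)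
      (f : hom X X') (g : hom Y Y') (h : hom Z Z'),
    assoc X' Y' Z' ∘ tensor_hom (tensor_hom f g) h =
    tensor_hom f (tensor_hom g h) ∘ assoc X Y Z;
  lunit_nat : forall (X Y : sm_cat) (f : hom X Y),
    lunit Y ∘ tensor_hom (idm unit_ob) f = f ∘ lunit X;
  runit_nat : forall (X Y : sm_cat) (f : hom X Y),
    runit Y ∘ tensor_hom f (idm unit_ob) = f ∘ runit X;
  braid_nat : forall (X Y X' Y' : sm_cat) (f : hom X X') (g : hom Y Y'),
    braid X' Y' ∘ tensor_hom f g = tensor_hom g f ∘ braid X Y;
  pentagon : forall W X Y Z : sm_cat,
    assoc W X (tensor Y Z) ∘ assoc (tensor W X) Y Z =
    tensor_hom (idm W) (assoc X Y Z)
      ∘ (assoc W (tensor X Y) Z ∘ tensor_hom (assoc W X Y) (idm Z));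
  triangle : forall X Y : sm_cat,
    tensor_hom (idm X) (lunit Y) ∘ assoc X unit_ob Y =
    tensor_hom (runit X) (idm Y);
  hexagon : forall X Y Z : sm_cat,
    assoc Y Z X ∘ (braid X (tensor Y Z) ∘ assoc X Y Z) =
    tensor_hom (idm Y) (braid X Z)
      ∘ (assoc Y X Z ∘ tensor_hom (braid X Y) (idm Z))
}.

Arguments unit_ob {s}.
Arguments tensor {s} X Y.
Arguments tensor_hom {s X Y X' Y'} f g : rename.
Arguments assoc {s} X Y Z.
Arguments assocV {s} X Y Z.
Arguments lunit {s} X.
Arguments lunitV {s} X.
Arguments runit {s} X.
Arguments runitV {s} X.
Arguments braid {s} X Y.
Notation "X ⊗ Y" := (tensor X Y) : cat_scope.
Notation "f ⊠ g" := (tensor_hom f g) : cat_scope.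

Definition swap_mid (C : symmetric_monoidal) (W X Y Z : C) :
    hom ((W ⊗ X) ⊗ (Y ⊗ Z)) ((W ⊗ Y) ⊗ (X ⊗ Z)) :=
  assocV W Y (X ⊗ Z)
    ∘ ((idm W ⊠ (assoc Y X Z ∘ ((braid X Y ⊠ idm Z) ∘ assocV X Y Z)))
        ∘ assoc W X (Y ⊗ Z)).

(* The middle swap X ⊗ X ⊗ Y ⊗ Y → X ⊗ Y ⊗ X ⊗ Y and the coherence
   isomorphism I ≅ I ⊗ I are inserted where the strict axioms omit them. *)
Record cd_category := CDCategory {
  cd_sm :> symmetric_monoidal;
  copy : forall X : cd_sm, hom X (X ⊗ X);
  del : forall X : cd_sm, hom X unit_ob;
  copy_assoc : forall X : cd_sm,
    assoc X X X ∘ ((copy X ⊠ idm X) ∘ copy X) = (idm X ⊠ copy X) ∘ copy X;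
  copy_dell : forall X : cd_sm, lunit X ∘ ((del X ⊠ idm X) ∘ copy X) = idm X;
  copy_delr : forall X : cd_sm, runit X ∘ ((idm X ⊠ del X) ∘ copy X) = idm X;
  copy_comm : forall X : cd_sm, braid X X ∘ copy X = copy X;
  copy_tensor : forall X Y : cd_sm,
    copy (X ⊗ Y) = swap_mid X X Y Y ∘ (copy X ⊠ copy Y);
  del_tensor : forall X Y : cd_sm,
    del (X ⊗ Y) = lunit unit_ob ∘ (del X ⊠ del Y);
  copy_unit : copy (@unit_ob cd_sm) = lunitV unit_ob;
  del_unit : del (@unit_ob cd_sm) = idm unit_ob
}.

Arguments copy {c} X.
Arguments del {c} X.

Definition total (C : cd_category) (X Y : C) (f : hom X Y) : Prop :=
  del Y ∘ f = del X.

Definition copyable (C : cd_category) (X Y : C) (f : hom X Y) : Prop :=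
  copy Y ∘ f = (f ⊠ f) ∘ copy X.

Definition deterministic (C : cd_category) (X Y : C) (f : hom X Y) : Prop :=
  total f /\ copyable f.

Record markov_category := MarkovCategory {
  markov_cd :> cd_category;
  markov_total : forall (X Y : markov_cd) (f : hom X Y), total f
}.

Definition positive (C : markov_category) : Prop :=
  forall (X Y Z : C) (u : hom X Y) (v : hom Y Z), deterministic (v ∘ u) ->
    (u ⊠ (v ∘ u)) ∘ copy X = (idm Y ⊠ v) ∘ (copy Y ∘ u).

Definition det_mono (C : markov_category) (X Y : C) (i : hom X Y) : Prop :=
  deterministic i /\ monic i.

Record partializable (C : markov_category) : Prop := Partializable {
  pz_positive : positive C;
  pz_pullback_ex : forall (X Y Z : C) (f : hom X Z) (j : hom Y Z),
    det_mono j ->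
    exists (P : C) (u : hom P X) (v : hom P Y), is_pullback f j u v;
  pz_pullback_det : forall (X Y Z : C) (f : hom X Z) (j : hom Y Z),
    det_mono j ->
    forall (P : C) (u : hom P X) (v : hom P Y), is_pullback f j u v ->
    det_mono u;
  pz_tensor_mono : forall (D X A : C) (i : hom D X),
    det_mono i -> monic (i ⊠ idm A)
}.

Record span (C : markov_category) (X Y : C) := Span {
  apex : C;
  leg : hom apex X;
  leg_dm : det_mono leg;
  val : hom apex Y
}.

Definition span_equiv (C : markov_category) (X Y : C) (s s' : span X Y) : Prop :=
  exists t : hom (apex s) (apex s'),
    is_iso t /\ leg s' ∘ t = leg s /\ val s' ∘ t = val s.

(* An equivalence class, as the predicate of belonging to it. *)
Definition partial_hom (C : markov_category) (X Y : C) : Type :=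
  {c : span X Y -> Prop | exists s, c = span_equiv s}.

Definition span_class (C : markov_category) (X Y : C) (s : span X Y) :
    partial_hom X Y :=
  exist _ (span_equiv s) (ex_intro _ s eq_refl).

Definition repr (C : markov_category) (X Y : C) (c : partial_hom X Y) : span X Y :=
  proj1_sig (constructive_indefinite_description _ (proj2_sig c)).

Section Facts.

Lemma comp_sq (C : category) (W X Y Y' Z : C) (g : hom Y Z) (f : hom X Y)
    (g' : hom Y' Z) (f' : hom X Y') (h : hom W X) :
  g ∘ f = g' ∘ f' -> g ∘ (f ∘ h) = g' ∘ (f' ∘ h).
Proof. by move=> e; rewrite !comp_assoc e. Qed.

Lemma monic_id (C : category) (X : C) : monic (idm X).
Proof. by move=> T a b; rewrite !comp_idl. Qed.

Lemma monic_comp (C : category) (X Y Z : C) (g : hom Y Z) (f : hom X Y) :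
  monic g -> monic f -> monic (g ∘ f).
Proof. by move=> mg mf T a b; rewrite -!comp_assoc => /mg/mf. Qed.

Lemma iso_monic (C : category) (X Y : C) (f : hom X Y) : is_iso f -> monic f.
Proof.
move=> [g [gf _]] T a b e.
by rewrite -(comp_idl a) -(comp_idl b) -gf -!comp_assoc e.
Qed.

Context {C : markov_category}.
Implicit Types X Y Z : C.

Lemma del_nat X Y (f : hom X Y) : del Y ∘ f = del X.
Proof. exact: markov_total. Qed.

Lemma copyable_det X Y (f : hom X Y) : copyable f -> deterministic f.
Proof. by split=> //; apply: markov_total. Qed.

Lemma det_id X : deterministic (idm X).
Proof.
by apply: copyable_det; rewrite /copyable tensor_id comp_idl comp_idr.
Qed.

Lemma det_comp X Y Z (g : hom Y Z) (f : hom X Y) :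
  deterministic g -> deterministic f -> deterministic (g ∘ f).
Proof.
move=> [_ cg] [_ cf]; apply: copyable_det; rewrite /copyable tensor_comp.
by rewrite comp_assoc cg -comp_assoc cf comp_assoc.
Qed.

Lemma det_mono_id X : det_mono (idm X).
Proof. by split; [exact: det_id | exact: monic_id]. Qed.

Lemma det_mono_comp X Y Z (g : hom Y Z) (f : hom X Y) :
  det_mono g -> det_mono f -> det_mono (g ∘ f).
Proof.
by move=> [dg mg] [df mf]; split; [exact: det_comp | exact: monic_comp].
Qed.

Lemma assocV_nat X Y Z X' Y' Z' (f : hom X X') (g : hom Y Y') (h : hom Z Z') :
  assocV X' Y' Z' ∘ (f ⊠ (g ⊠ h)) = ((f ⊠ g) ⊠ h) ∘ assocV X Y Z.
Proof.
rewrite -[LHS]comp_idr -(assocVK X Y Z) -comp_assoc.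
rewrite (comp_assoc (f ⊠ _)) -assoc_nat -comp_assoc.
by rewrite comp_assoc assocK comp_idl.
Qed.

Lemma swap_mid_nat W X Y Z W' X' Y' Z'
    (a : hom W W') (b : hom X X') (c : hom Y Y') (d : hom Z Z') :
  swap_mid W' X' Y' Z' ∘ ((a ⊠ b) ⊠ (c ⊠ d)) =
  ((a ⊠ c) ⊠ (b ⊠ d)) ∘ swap_mid W X Y Z.
Proof.
rewrite /swap_mid -!comp_assoc assoc_nat.
rewrite [in LHS](comp_assoc (idm W' ⊠ _)) -tensor_comp comp_idl -!comp_assoc.
rewrite assocV_nat [in LHS](comp_assoc (braid X' Y' ⊠ _)) -tensor_comp braid_nat.
rewrite comp_idl -{1}(comp_idr d) tensor_comp -comp_assoc.
rewrite [in LHS](comp_assoc (assoc Y' X' Z')) assoc_nat -comp_assoc.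
by rewrite -{1}(comp_idr a) tensor_comp -comp_assoc comp_assoc assocV_nat -comp_assoc.
Qed.

Lemma braid_unit : braid (@unit_ob C) unit_ob = idm _.
Proof.
rewrite -[LHS]comp_idr -(lunitK unit_ob) comp_assoc -copy_unit copy_comm.
by rewrite copy_unit lunitK.
Qed.

Lemma swap_mid_unit X Y : swap_mid X (@unit_ob C) unit_ob Y = idm _.
Proof.
by rewrite /swap_mid braid_unit tensor_id comp_idl assocVK tensor_id comp_idl assocK.
Qed.

Definition margl X Y : hom (X ⊗ Y) X := runit X ∘ (idm X ⊠ del Y).
Definition margr X Y : hom (X ⊗ Y) Y := lunit Y ∘ (del X ⊠ idm Y).

Lemma marg_copy X Y : (margl X Y ⊠ margr X Y) ∘ copy (X ⊗ Y) = idm _.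
Proof.
rewrite copy_tensor /margl /margr tensor_comp -comp_assoc.
rewrite (comp_assoc (_ ⊠ _) (swap_mid _ _ _ _)) -swap_mid_nat swap_mid_unit comp_idl.
by rewrite -!tensor_comp copy_dell copy_delr tensor_id.
Qed.

Lemma margl_nat X Y X' Y' (f : hom X X') (g : hom Y Y') :
  margl X' Y' ∘ (f ⊠ g) = f ∘ margl X Y.
Proof.
rewrite /margl -comp_assoc -tensor_comp del_nat comp_idl.
by rewrite -{1}(comp_idr f) -{1}(comp_idl (del Y)) tensor_comp comp_assoc
  runit_nat -comp_assoc.
Qed.

Lemma margr_nat X Y X' Y' (f : hom X X') (g : hom Y Y') :
  margr X' Y' ∘ (f ⊠ g) = g ∘ margr X Y.
Proof.
rewrite /margr -comp_assoc -tensor_comp del_nat comp_idl.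
by rewrite -{1}(comp_idr g) -{1}(comp_idl (del X)) tensor_comp comp_assoc
  lunit_nat -comp_assoc.
Qed.

Lemma det_pair T X Y (m : hom T (X ⊗ Y)) : deterministic m ->
  ((margl X Y ∘ m) ⊠ (margr X Y ∘ m)) ∘ copy T = m.
Proof.
by move=> [_ cm]; rewrite tensor_comp -comp_assoc -cm comp_assoc marg_copy comp_idl.
Qed.

Lemma det_tensor X Y X' Y' (f : hom X Y) (g : hom X' Y') :
  deterministic f -> deterministic g -> deterministic (f ⊠ g).
Proof.
move=> [_ cf] [_ cg]; apply: copyable_det; rewrite /copyable !copy_tensor.
rewrite -comp_assoc -tensor_comp cf cg tensor_comp comp_assoc swap_mid_nat.
by rewrite -comp_assoc.
Qed.

End Facts.

Section SpanFacts.
Context {C : markov_category}.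
Implicit Types X Y Z : C.

Definition span_le X Y (s s' : span X Y) : Prop :=
  exists t : hom (apex s) (apex s'), leg s' ∘ t = leg s /\ val s' ∘ t = val s.

Lemma span_leP X Y (s s' : span X Y) :
  span_le s s' -> span_le s' s -> span_equiv s s'.
Proof.
move=> [t [lt vt]] [r [lr vr]]; exists t; split=> //; exists r; split.
- by apply: (proj2 (leg_dm s)); rewrite comp_assoc lr lt comp_idr.
- by apply: (proj2 (leg_dm s')); rewrite comp_assoc lt lr comp_idr.
Qed.

Lemma span_equiv_le X Y (s s' : span X Y) :
  span_equiv s s' -> span_le s s' /\ span_le s' s.
Proof.
move=> [t [[r [rt tr]] [lt vt]]]; split; first by exists t.
exists r; split; first by rewrite -lt -comp_assoc tr comp_idr.
by rewrite -vt -comp_assoc tr comp_idr.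
Qed.

Lemma span_le_trans X Y (s1 s2 s3 : span X Y) :
  span_le s1 s2 -> span_le s2 s3 -> span_le s1 s3.
Proof.
move=> [t [lt vt]] [r [lr vr]]; exists (r ∘ t).
by rewrite !comp_assoc lr vr lt vt.
Qed.

Lemma span_equiv_refl X Y (s : span X Y) : span_equiv s s.
Proof. by apply: span_leP; exists (idm _); rewrite !comp_idr. Qed.

Lemma span_equiv_sym X Y (s s' : span X Y) : span_equiv s s' -> span_equiv s' s.
Proof. by move=> /span_equiv_le[? ?]; apply: span_leP. Qed.

Lemma span_equiv_trans X Y (s1 s2 s3 : span X Y) :
  span_equiv s1 s2 -> span_equiv s2 s3 -> span_equiv s1 s3.
Proof.
move=> /span_equiv_le[? ?] /span_equiv_le[? ?].
by apply: span_leP; apply: span_le_trans; eassumption.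
Qed.

Lemma span_classP X Y (s s' : span X Y) :
  span_class s = span_class s' <-> span_equiv s s'.
Proof.
split=> [[e] | e]; first by rewrite e; exact: span_equiv_refl.
apply: subset_eq_compat.
apply: functional_extensionality => r; apply: propositional_extensionality.
split=> ?; apply: span_equiv_trans; try eassumption.
by apply: span_equiv_sym.
Qed.

Lemma span_class_le X Y (s s' : span X Y) :
  span_le s s' -> span_le s' s -> span_class s = span_class s'.
Proof. by move=> ? ?; apply/span_classP/span_leP. Qed.

Lemma reprK X Y (c : partial_hom X Y) : span_class (repr c) = c.
Proof.
rewrite /repr; case: constructive_indefinite_description => s /=.
by case: c => P hP /= e; apply: subset_eq_compat; rewrite e.
Qed.

Lemma repr_class X Y (s : span X Y) : span_equiv (repr (span_class s)) s.
Proof. by apply/span_classP; rewrite reprK. Qed.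

Lemma class_ex X Y (c : partial_hom X Y) : exists s, c = span_class s.
Proof. by exists (repr c); rewrite reprK. Qed.

End SpanFacts.

Section Partial.
Context {C : markov_category} (hC : partializable C).
Implicit Types X Y Z : C.

Lemma span_pullback_ex X Y Z (s : span X Y) (s' : span Y Z) :
  exists p : {P : C & (hom P (apex s) * hom P (apex s'))%type},
    is_pullback (val s) (leg s') (fst (projT2 p)) (snd (projT2 p)).
Proof.
have [P [u [v h]]] := pz_pullback_ex hC (val s) (leg_dm s').
by exists (existT _ P (u, v)).
Qed.

Definition span_comp X Y Z (s : span X Y) (s' : span Y Z) : span X Z :=
  let (p, hp) := constructive_indefinite_description _ (span_pullback_ex s s') in
  Span (det_mono_comp (leg_dm s) (pz_pullback_det hC (leg_dm s') hp))
    (val s' ∘ snd (projT2 p)).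

Definition partial_comp X Y Z (d : partial_hom Y Z) (c : partial_hom X Y) :
    partial_hom X Z :=
  span_class (span_comp (repr c) (repr d)).

Definition incl X Y (f : hom X Y) : partial_hom X Y :=
  span_class (Span (det_mono_id X) f).

Lemma monic_tensor X Y X' Y' (i : hom X Y) (j : hom X' Y') :
  det_mono i -> det_mono j -> monic (i ⊠ j).
Proof.
move=> hi hj; rewrite -(comp_idr i) -(comp_idl j) tensor_comp.
apply: monic_comp; first exact: pz_tensor_mono.
suff -> : idm X ⊠ j = braid Y' X ∘ ((j ⊠ idm X) ∘ braid X X').
  apply: monic_comp; first by apply: iso_monic; exists (braid X Y'); rewrite !braidK.
  apply: monic_comp; first exact: pz_tensor_mono.
  by apply: iso_monic; exists (braid X' X); rewrite !braidK.
by rewrite -braid_nat comp_assoc braidK comp_idl.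
Qed.

Lemma det_mono_tensor X Y X' Y' (i : hom X Y) (j : hom X' Y') :
  det_mono i -> det_mono j -> det_mono (i ⊠ j).
Proof.
move=> hi hj; split; last exact: monic_tensor.
by case: hi hj => ? _ [? _]; apply: det_tensor.
Qed.

Definition span_tensor X Y X' Y' (s : span X Y) (s' : span X' Y') :
    span (X ⊗ X') (Y ⊗ Y') :=
  Span (det_mono_tensor (leg_dm s) (leg_dm s')) (val s ⊠ val s').

Definition partial_tensor X Y X' Y' (c : partial_hom X Y) (d : partial_hom X' Y') :
    partial_hom (X ⊗ X') (Y ⊗ Y') :=
  span_class (span_tensor (repr c) (repr d)).

(* Composites and tensor products may be computed on any representatives,
   and composites with any pullback. *)

Lemma comp_le X Y Z (s s0 : span X Y) (s' s0' : span Y Z) P P0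
    (u : hom P (apex s)) (v : hom P (apex s'))
    (u0 : hom P0 (apex s0)) (v0 : hom P0 (apex s0')) hu hu0 :
  span_le s s0 -> span_le s' s0' ->
  is_pullback (val s) (leg s') u v -> is_pullback (val s0) (leg s0') u0 v0 ->
  span_le (@Span _ X Z P (leg s ∘ u) hu (val s' ∘ v))
          (@Span _ X Z P0 (leg s0 ∘ u0) hu0 (val s0' ∘ v0)).
Proof.
move=> [t [lt vt]] [r [lr vr]] [uv _] [_ univ].
have [|w [[uw vw] _]] := univ P (t ∘ u) (r ∘ v).
  by rewrite !comp_assoc vt lr.
by exists w => /=; rewrite -!comp_assoc uw vw !comp_assoc lt vr.
Qed.

Lemma comp_classE X Y Z (s : span X Y) (s' : span Y Z) P
    (u : hom P (apex s)) (v : hom P (apex s')) (hu : det_mono (leg s ∘ u)) :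
  is_pullback (val s) (leg s') u v ->
  partial_comp (span_class s') (span_class s) = span_class (Span hu (val s' ∘ v)).
Proof.
move=> pb; rewrite /partial_comp /span_comp.
case: constructive_indefinite_description => [[P0 [u0 v0]] pb0].
have [? ?] := span_equiv_le (repr_class s).
have [? ?] := span_equiv_le (repr_class s').
by apply: span_class_le; apply: comp_le.
Qed.

Lemma comp_classP X Y Z (s : span X Y) (s' : span Y Z) :
  exists P (u : hom P (apex s)) (v : hom P (apex s')) (hu : det_mono (leg s ∘ u)),
  is_pullback (val s) (leg s') u v /\
  partial_comp (span_class s') (span_class s) = span_class (Span hu (val s' ∘ v)).
Proof.
have [P [u [v pb]]] := pz_pullback_ex hC (val s) (leg_dm s').
have hu := det_mono_comp (leg_dm s) (pz_pullback_det hC (leg_dm s') pb).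
by exists P, u, v, hu; split=> //; apply: comp_classE.
Qed.

Lemma tensor_classE X Y X' Y' (s : span X Y) (s' : span X' Y') :
  partial_tensor (span_class s) (span_class s') = span_class (span_tensor s s').
Proof.
have le t t0 t' t0' : @span_le _ X Y t t0 -> @span_le _ X' Y' t' t0' ->
    span_le (span_tensor t t') (span_tensor t0 t0').
  move=> [a [la va]] [b [lb vb]]; exists (a ⊠ b) => /=.
  by rewrite -!tensor_comp la va lb vb.
have [? ?] := span_equiv_le (repr_class s).
have [? ?] := span_equiv_le (repr_class s').
by apply: span_class_le; apply: le.
Qed.

Lemma pullback_id X Y (f : hom X Y) : is_pullback f (idm Y) (idm X) f.
Proof.
split; first by rewrite comp_idl comp_idr.
move=> T a b; rewrite comp_idl => <-; exists a; split.
  by rewrite comp_idl.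
by move=> w [<- _]; rewrite comp_idl.
Qed.

Lemma comp_inclE X Y Z (s : span X Y) (g : hom Y Z) :
  partial_comp (incl g) (span_class s) = span_class (Span (leg_dm s) (g ∘ val s)).
Proof.
have hu : det_mono (leg s ∘ idm _) by rewrite comp_idr; apply: leg_dm.
rewrite (comp_classE (s' := Span (det_mono_id Y) g) hu (pullback_id (val s))).
by apply: span_class_le; exists (idm _); rewrite /= !comp_idr.
Qed.

Lemma incl_compE X Y Z (f : hom X Y) (s : span Y Z) P
    (u : hom P X) (v : hom P (apex s)) (hu : det_mono u) :
  is_pullback f (leg s) u v ->
  partial_comp (span_class s) (incl f) = span_class (Span hu (val s ∘ v)).
Proof.
move=> pb; have hu' : det_mono (leg (Span (det_mono_id X) f) ∘ u).
  by rewrite /= comp_idl.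
rewrite (comp_classE hu' pb).
by apply: span_class_le; exists (idm _); rewrite /= ?comp_idr ?comp_idl.
Qed.

Lemma incl_comp X Y Z (g : hom Y Z) (f : hom X Y) :
  partial_comp (incl g) (incl f) = incl (g ∘ f).
Proof. by rewrite {2}/incl comp_inclE. Qed.

Lemma incl_tensor X Y X' Y' (f : hom X Y) (g : hom X' Y') :
  partial_tensor (incl f) (incl g) = incl (f ⊠ g).
Proof.
rewrite /incl tensor_classE /span_tensor /=.
by apply: span_class_le; exists (idm _); rewrite /= ?tensor_id ?comp_idl ?comp_idr.
Qed.

Lemma partial_idl X Y (c : partial_hom X Y) : partial_comp (incl (idm Y)) c = c.
Proof.
have [[A i hi f] ->] := class_ex c; rewrite comp_inclE /=.
by apply: span_class_le; exists (idm _); rewrite /= ?comp_idl ?comp_idr.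
Qed.

Lemma partial_idr X Y (c : partial_hom X Y) : partial_comp c (incl (idm X)) = c.
Proof.
have [[A i hi f] ->] := class_ex c.
rewrite (@incl_compE _ _ _ _ (Span hi f) A i (idm A) hi) /=; last first.
  by apply: span_class_le; exists (idm _); rewrite /= ?comp_idl ?comp_idr.
split; first by rewrite comp_idl comp_idr.
move=> T a b; rewrite comp_idl => ->; exists b; split; first by rewrite comp_idl.
by move=> w [_ <-]; rewrite comp_idl.
Qed.

Lemma partial_assoc W X Y Z (e : partial_hom Y Z) (d : partial_hom X Y)
    (c : partial_hom W X) :
  partial_comp e (partial_comp d c) = partial_comp (partial_comp e d) c.
Proof.
have [s1 ->] := class_ex c; have [s2 ->] := class_ex d.
have [s3 ->] := class_ex e.
have [P [u [v [hu [pb1 ->]]]]] := comp_classP s1 s2.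
have [Q [u' [v' [hu' [pb2 ->]]]]] := comp_classP s2 s3.
set s12 := Span hu _; set s23 := Span hu' _.
have [R [p [q [hp [pb3 ->]]]]] := comp_classP s12 s3.
have [S [p' [q' [hp' [pb4 ->]]]]] := comp_classP s1 s23.
case: pb1 pb2 pb3 pb4 => e1 un1 [e2 un2] /= [e3 un3] [e4 un4].
apply: span_class_le.
- have [|w [[uw vw] _]] := un2 R (v ∘ p) q; first by rewrite comp_assoc.
  have [|z [[pz qz] _]] := un4 R (u ∘ p) w.
    by rewrite -comp_assoc uw !comp_assoc e1.
  by exists z; rewrite /= -!comp_assoc pz qz vw.
- have [|w [[uw vw] _]] := un1 S p' (u' ∘ q'); first by rewrite e4 comp_assoc.
  have [|z [[pz qz] _]] := un3 S w (v' ∘ q').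
    by rewrite -comp_assoc vw !comp_assoc e2.
  by exists z; rewrite /= -!comp_assoc pz qz uw.
Qed.

Definition partial_cat : category := {|
  obj := C;
  hom := @partial_hom C;
  idm := fun X => incl (idm X);
  comp := partial_comp;
  comp_idl := partial_idl;
  comp_idr := partial_idr;
  comp_assoc := partial_assoc
|}.

(* A pullback of a tensor product of deterministic monomorphisms embeds
   deterministically into a tensor product, hence is the pairing of its
   marginals; these factor through the two given pullbacks. *)
Lemma pullback_tensor X Y Z P X' Y' Z' P'
    (f : hom X Z) (j : hom Y Z) (u : hom P X) (v : hom P Y)
    (f' : hom X' Z') (j' : hom Y' Z') (u' : hom P' X') (v' : hom P' Y') :
  det_mono j -> det_mono j' ->
  is_pullback f j u v -> is_pullback f' j' u' v' ->
  is_pullback (f ⊠ f') (j ⊠ j') (u ⊠ u') (v ⊠ v').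
Proof.
move=> hj hj' pb pb'.
have hu := pz_pullback_det hC hj pb; have hu' := pz_pullback_det hC hj' pb'.
have mu := monic_tensor hu hu'; have hjj := det_mono_tensor hj hj'.
case: pb pb' => e un [e' un'].
have ee : (f ⊠ f') ∘ (u ⊠ u') = (j ⊠ j') ∘ (v ⊠ v').
  by rewrite -!tensor_comp e e'.
split=> // T a b ab.
have [Q [m [q pbQ]]] := pz_pullback_ex hC (f ⊠ f') hjj.
have [dm _] := pz_pullback_det hC hjj pbQ.
case: pbQ => eQ unQ; have [t [[mt _] _]] := unQ _ _ _ ab.
have [|c [[uc _] _]] := un Q (margl _ _ ∘ m) (margl _ _ ∘ q).
  by rewrite (comp_assoc f) (comp_assoc j) -(margl_nat f f') -(margl_nat j j') -!comp_assoc eQ.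
have [|c' [[uc' _] _]] := un' Q (margr _ _ ∘ m) (margr _ _ ∘ q).
  by rewrite (comp_assoc f') (comp_assoc j') -(margr_nat f f') -(margr_nat j j') -!comp_assoc eQ.
have uw : (u ⊠ u') ∘ ((c ⊠ c') ∘ (copy Q ∘ t)) = a.
  by rewrite (comp_assoc (u ⊠ u')) -tensor_comp uc uc' comp_assoc det_pair.
exists ((c ⊠ c') ∘ (copy Q ∘ t)); split; last first.
  by move=> w [uw' _]; apply: mu; rewrite uw.
split=> //; apply: (proj2 hjj).
by rewrite -ab -uw comp_assoc -ee -comp_assoc.
Qed.

Lemma partial_tensor_id X Y :
  partial_tensor (incl (idm X)) (incl (idm Y)) = incl (idm (X ⊗ Y)).
Proof. by rewrite incl_tensor tensor_id. Qed.

Lemma partial_tensor_comp X Y Z X' Y' Z'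
    (d : partial_hom Y Z) (c : partial_hom X Y)
    (d' : partial_hom Y' Z') (c' : partial_hom X' Y') :
  partial_tensor (partial_comp d c) (partial_comp d' c') =
  partial_comp (partial_tensor d d') (partial_tensor c c').
Proof.
have [s ->] := class_ex c; have [r ->] := class_ex d.
have [s' ->] := class_ex c'; have [r' ->] := class_ex d'.
have [P [u [v [hu [pb ->]]]]] := comp_classP s r.
have [P' [u' [v' [hu' [pb' ->]]]]] := comp_classP s' r'.
rewrite !tensor_classE.
have pb2 := pullback_tensor (leg_dm r) (leg_dm r') pb pb'.
have h2 : det_mono (leg (span_tensor s s') ∘ (u ⊠ u')).
  by rewrite /= -tensor_comp; apply: det_mono_tensor.
rewrite (comp_classE (s' := span_tensor r r') h2 pb2).
by apply: span_class_le; exists (idm _); rewrite /= -!tensor_comp !comp_idr.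
Qed.

Lemma incl_nat X Y X' Y' (a : hom X X') (b : hom Y Y')
    (s : span X Y) (s' : span X' Y') (c : hom (apex s) (apex s')) :
  is_iso a -> is_iso c ->
  a ∘ leg s = leg s' ∘ c -> b ∘ val s = val s' ∘ c ->
  partial_comp (incl b) (span_class s) = partial_comp (span_class s') (incl a).
Proof.
move=> ia [c' [c'c cc']] la vb.
rewrite comp_inclE (incl_compE (v := c) (leg_dm s)) ?vb //; split=> // T p q pq.
have e : leg s ∘ (c' ∘ q) = p.
  apply: (iso_monic ia); rewrite comp_assoc la pq.
  by rewrite -comp_assoc (comp_assoc c) cc' comp_idl.
exists (c' ∘ q); split.
  by split=> //; rewrite comp_assoc cc' comp_idl.
by move=> w [_ <-]; rewrite comp_assoc c'c comp_idl.
Qed.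

Lemma partial_assoc_nat X Y Z X' Y' Z'
    (c : partial_hom X X') (d : partial_hom Y Y') (e : partial_hom Z Z') :
  partial_comp (incl (assoc X' Y' Z')) (partial_tensor (partial_tensor c d) e) =
  partial_comp (partial_tensor c (partial_tensor d e)) (incl (assoc X Y Z)).
Proof.
have [s1 ->] := class_ex c; have [s2 ->] := class_ex d.
have [s3 ->] := class_ex e; rewrite !tensor_classE.
apply: (@incl_nat _ _ _ _ _ _
  (span_tensor (span_tensor s1 s2) s3) (span_tensor s1 (span_tensor s2 s3))
  (assoc (apex s1) (apex s2) (apex s3))) => /=.
- by exists (assocV X Y Z); rewrite assocK assocVK.
- by exists (assocV _ _ _); rewrite assocK assocVK.
- exact: assoc_nat.
- exact: assoc_nat.
Qed.

Lemma partial_lunit_nat X Y (c : partial_hom X Y) :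
  partial_comp (incl (lunit Y)) (partial_tensor (incl (idm unit_ob)) c) =
  partial_comp c (incl (lunit X)).
Proof.
have [s ->] := class_ex c; rewrite /incl tensor_classE.
apply: (@incl_nat _ _ _ _ _ _
  (span_tensor (Span (det_mono_id unit_ob) (idm unit_ob)) s) (s)
  (lunit (apex s))) => /=.
- by exists (lunitV _); rewrite lunitK lunitVK.
- by exists (lunitV _); rewrite lunitK lunitVK.
- exact: lunit_nat.
- exact: lunit_nat.
Qed.

Lemma partial_runit_nat X Y (c : partial_hom X Y) :
  partial_comp (incl (runit Y)) (partial_tensor c (incl (idm unit_ob))) =
  partial_comp c (incl (runit X)).
Proof.
have [s ->] := class_ex c; rewrite /incl tensor_classE.
apply: (@incl_nat _ _ _ _ _ _
  (span_tensor s (Span (det_mono_id unit_ob) (idm unit_ob))) (s)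
  (runit (apex s))) => /=.
- by exists (runitV _); rewrite runitK runitVK.
- by exists (runitV _); rewrite runitK runitVK.
- exact: runit_nat.
- exact: runit_nat.
Qed.

Lemma partial_braid_nat X Y X' Y' (c : partial_hom X X') (d : partial_hom Y Y') :
  partial_comp (incl (braid X' Y')) (partial_tensor c d) =
  partial_comp (partial_tensor d c) (incl (braid X Y)).
Proof.
have [s ->] := class_ex c; have [r ->] := class_ex d; rewrite !tensor_classE.
apply: (@incl_nat _ _ _ _ _ _
  (span_tensor s r) (span_tensor r s)
  (braid (apex s) (apex r))) => /=.
- by exists (braid _ _); rewrite !braidK.
- by exists (braid _ _); rewrite !braidK.
- exact: braid_nat.
- exact: braid_nat.
Qed.

Definition partial_sm : symmetric_monoidal.
Proof.
refine (@SymmetricMonoidal partial_cat (@unit_ob C) (@tensor C) partial_tensor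
  (fun X Y Z => incl (assoc X Y Z)) (fun X Y Z => incl (assocV X Y Z))
  (fun X => incl (lunit X)) (fun X => incl (lunitV X))
  (fun X => incl (runit X)) (fun X => incl (runitV X))
  (fun X Y => incl (braid X Y))
  partial_tensor_id partial_tensor_comp _ _ _ _ _ _ _
  partial_assoc_nat partial_lunit_nat partial_runit_nat partial_braid_nat
  _ _ _) => /= *; rewrite ?incl_tensor ?incl_comp ?incl_tensor ?incl_comp; congr incl.
- exact: assocVK.
- exact: assocK.
- exact: lunitVK.
- exact: lunitK.
- exact: runitVK.
- exact: runitK.
- exact: braidK.
- exact: pentagon.
- exact: triangle.
- exact: hexagon.
Defined.

Lemma partial_swap_mid (W X Y Z : C) :
  @swap_mid partial_sm W X Y Z = incl (@swap_mid C W X Y Z).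
Proof.
by rewrite /swap_mid /= !(incl_comp, incl_tensor).
Qed.

Definition Partial : cd_category.
Proof.
refine (@CDCategory partial_sm
  (fun X => incl (copy X)) (fun X => incl (del X)) _ _ _ _ _ _ _ _)
  => /= *; rewrite ?partial_swap_mid /= ?(incl_comp, incl_tensor); congr incl.
- exact: copy_assoc.
- exact: copy_dell.
- exact: copy_delr.
- exact: copy_comm.
- exact: copy_tensor.
- exact: del_tensor.
- exact: copy_unit.
- exact: del_unit.
Defined.

End Partial.

(* Main.v *)
From Stdlib Require Import ssreflect ssrfun.
Require Import Defs.

Set Implicit Arguments.
Unset Strict Implicit.
Unset Printing Implicit Defensive.
Local Open Scope cat_scope.

(** Restricting copy on X to a subobject i : D → X with i deterministic gives
    copy on D: the pullback of i ⊠ i along copy X is D itself, with projections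
    i and copy D ([pullback_copy]).  Hence, for the span s = (D, i, f), the
    two sides of the copyability equation are spans with the same left leg:
    copy ∘ s is (D, i, copy Y ∘ f) by [comp_inclE], and (s ⊠ s) ∘ copy is
    (D, i, (f ⊠ f) ∘ copy D).  As i is monic, an isomorphism between two such
    spans can only be the identity ([span_class_val]), so the spans are
    equivalent exactly when copy Y ∘ f = (f ⊠ f) ∘ copy D, which says that f is
    copyable; totality is automatic in a Markov category. *)

Lemma span_class_val (C : markov_category) (X D Y : C) (i : hom D X)
    (hi hi' : det_mono i) (f g : hom D Y) :
  span_class (Span hi f) = span_class (Span hi' g) <-> f = g.
Proof.
split=> [/span_classP [t [_ /= [it gt]]] | ->].
  have t1 : t = idm D by apply: (proj2 hi); rewrite it comp_idr.
  by rewrite -gt t1 comp_idr.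
by apply: span_class_le; exists (idm D); rewrite !comp_idr.
Qed.

Lemma margl_copy (C : markov_category) (X : C) : margl X X ∘ copy X = idm X.
Proof. by rewrite /margl -comp_assoc copy_delr. Qed.

(** If copy X ∘ a = (i ⊠ i) ∘ b, then taking the first marginal of both sides
    shows that a factors through i, via the first marginal of b.  That this
    factorization also recovers b follows by cancelling the monomorphism
    i ⊠ i. *)
Lemma pullback_copy (C : markov_category) (hC : partializable C) (X D : C)
    (i : hom D X) :
  det_mono i -> is_pullback (copy X) (i ⊠ i) i (copy D).
Proof.
move=> hi; have [[_ ci] mi] := hi; split=> // T a b ab.
have ia : i ∘ (margl D D ∘ b) = a.
  by rewrite comp_assoc -(margl_nat i i) -comp_assoc -ab comp_assoc
    margl_copy comp_idl.
exists (margl D D ∘ b); split; last by move=> w [iw _]; apply: mi; rewrite ia.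
split=> //; apply: (monic_tensor hC hi hi).
by rewrite comp_assoc -ci -comp_assoc ia.
Qed.

Theorem proposition1p8 (C : markov_category) (hC : partializable C)
    (X D Y : C) (i : hom D X) (hi : det_mono i) (f : hom D Y) :
  @copyable (Partial hC) X Y (span_class (Span hi f)) <-> deterministic f.
Proof.
rewrite /copyable /= comp_inclE tensor_classE.
rewrite (incl_compE (s := span_tensor hC (Span hi f) (Span hi f)) hC hi
  (pullback_copy hC hi)) /=.
split=> [/span_class_val | [_ cf]]; first exact: copyable_det.
by apply/span_class_val.
Qed.
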